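(* Work in ZF (the Axiom of Choice is not assumed). Let $\lambda$ and $\nu$ be well-ordered cardinals (initial ordinals) and let $\mathfrak m$ be an arbitrary cardinal. If $\mathrm{Cov}(<\!\lambda,\mathfrak m,\nu)$ holds, then $\nu\le^{*}\lambda\cdot\mathfrak m$, and consequently $\nu^+\le\aleph^*(\lambda\cdot\mathfrak m)$.
   Context: For a set $X$, $|X|$ denotes its cardinal; $|X|=|Y|$ means there is a bijection between $X$ and $Y$. A cardinal is well-ordered if it is the cardinal of a well-orderable set; such cardinals are identified with initial von Neumann ordinals. $|X|\le|Y|$ means $X$ is empty or there is an injection of $X$ into $Y$; $|X|<|Y|$ means $|X|\le|Y|$ and $|X|\neq|Y|$. $|X|\le^{*}|Y|$ means $X$ is empty or there is a surjection of $Y$ onto $X$. Products: $|X|\cdot|Y|=|X\times Y|$. The Lindenbaum function is $\aleph^*(\mathfrak n)=\{\alpha\in\mathrm{Ord}: |\alpha|\le^{*}\mathfrak n\}$ (the least ordinal $\alpha$ with $|\alpha|\not\le^*\mathfrak n$); the Hartogs function is $\aleph(\mathfrak n)=\{\alpha\in\mathrm{Ord}:|\alpha|\le\mathfrak n\}$, and for well-ordered $\nu$, $\nu^+$ denotes $\aleph(\nu)$. For a class $\mathfrak L$ of cardinals and cardinals $\mathfrak m,\mathfrak n$, $\mathrm{Cov}(\mathfrak L,\mathfrak m,\mathfrak n)$ means: a set of size $\mathfrak n$ can be covered by $\mathfrak m$ sets whose sizes belong to $\mathfrak L$, i.e. there are a set $X$ with $|X|=\mathfrak n$ and a family $\langle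 A_i:i\in I\rangle$ with $|I|=\mathfrak m$, each $|A_i|\in\mathfrak L$, and $X\subseteq\bigcup_{i\in I}A_i$. $\mathrm{Cov}(\mathfrak l,\mathfrak m,\mathfrak n)$ means $\mathrm{Cov}(\{\mathfrak l\},\mathfrak m,\mathfrak n)$, and $\mathrm{Cov}(<\!\mathfrak l,\mathfrak m,\mathfrak n)$ means $\mathrm{Cov}(\{\mathfrak k:\mathfrak k<\mathfrak l\},\mathfrak m,\mathfrak n)$. *)

(* Defs.v *)
(* Uses only the prelude. ZF is first-order ZF: statements are about an arbitrary model of
   the ZF axioms, and Separation and Replacement range over deeply embedded formulas
   of the language of set theory (with parameters). Ranging over all Rocq
   predicates instead would make the Axiom of Choice true in every model as soon
   as Rocq's own choice axioms are available. *)

Record structure : Type := Structure {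
  carrier :> Type;
  mem : carrier -> carrier -> Prop
}.

Arguments mem {_} _ _.

Notation "x ∈ y" := (mem x y) (at level 70, no associativity).

(* Variables are de Bruijn indices: fAll and fEx bind index 0. *)
Inductive formula : Type :=
  | fMem (i j : nat)
  | fEq (i j : nat)
  | fNot (p : formula)
  | fAnd (p q : formula)
  | fOr (p q : formula)
  | fImp (p q : formula)
  | fAll (p : formula)
  | fEx (p : formula).

Definition scons {T : Type} (x : T) (e : nat -> T) (n : nat) : T :=
  match n with
  | O => x
  | S k => e k
  end.

Fixpoint sat {M : structure} (e : nat -> M) (p : formula) : Prop :=
  match p with
  | fMem i j => e i ∈ e j
  | fEq i j => e i = e j
  | fNot p => ~ sat e p
  | fAnd p q => sat e p /\ sat e q
  | fOr p q => sat e p \/ sat e q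
  | fImp p q => sat e p -> sat e q
  | fAll p => forall x : M, sat (scons x e) p
  | fEx p => exists x : M, sat (scons x e) p
  end.

Definition subset {M : structure} (x y : M) : Prop :=
  forall z : M, z ∈ x -> z ∈ y.

Definition is_empty {M : structure} (x : M) : Prop :=
  forall z : M, ~ z ∈ x.

Record ZF (M : structure) : Prop := {
  zf_extensionality :
    forall x y : M, (forall z : M, z ∈ x <-> z ∈ y) -> x = y;
  zf_foundation :
    forall x : M, ~ is_empty x ->
      exists y : M, y ∈ x /\ forall z : M, z ∈ x -> ~ z ∈ y;
  zf_pairing :
    forall x y : M, exists p : M, forall z : M, z ∈ p <-> z = x \/ z = y;
  zf_union :
    forall x : M, exists u : M,
      forall z : M, z ∈ u <-> exists y : M, y ∈ x /\ z ∈ y;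
  zf_power :
    forall x : M, exists p : M, forall z : M, z ∈ p <-> subset z x;
  zf_infinity :
    exists w : M,
      (exists z : M, z ∈ w /\ is_empty z) /\
      forall x : M, x ∈ w ->
        exists y : M, y ∈ w /\ forall z : M, z ∈ y <-> z ∈ x \/ z = x;
  zf_separation :
    forall (p : formula) (e : nat -> M) (a : M),
      exists b : M, forall x : M, x ∈ b <-> x ∈ a /\ sat (scons x e) p;
  zf_replacement :
    forall (p : formula) (e : nat -> M) (a : M),
      (forall x y y' : M, x ∈ a ->
         sat (scons x (scons y e)) p -> sat (scons x (scons y' e)) p ->
         y = y') ->
      exists b : M, forall y : M,
        y ∈ b <-> exists x : M, x ∈ a /\ sat (scons x (scons y e)) p
}.

(* z = {x, y} *)
Definition is_upair {M : structure} (z x y : M) : Prop :=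
  forall u : M, u ∈ z <-> u = x \/ u = y.

(* z is the Kuratowski pair {{x, x}, {x, y}} *)
Definition is_pair {M : structure} (z x y : M) : Prop :=
  forall u : M, u ∈ z <-> is_upair u x x \/ is_upair u x y.

(* P = X * Y *)
Definition is_product {M : structure} (P X Y : M) : Prop :=
  forall z : M, z ∈ P <-> exists x y : M, x ∈ X /\ y ∈ Y /\ is_pair z x y.

Definition app {M : structure} (f x y : M) : Prop :=
  exists z : M, is_pair z x y /\ z ∈ f.

Definition function_on {M : structure} (f X : M) : Prop :=
  (forall z : M, z ∈ f -> exists x y : M, x ∈ X /\ is_pair z x y) /\
  (forall x : M, x ∈ X -> exists y : M, app f x y) /\
  (forall x y y' : M, app f x y -> app f x y' -> y = y').

Definition maps_to {M : structure} (f X Y : M) : Prop :=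
  function_on f X /\ forall x y : M, app f x y -> y ∈ Y.

Definition injection {M : structure} (f X Y : M) : Prop :=
  maps_to f X Y /\ forall x x' y : M, app f x y -> app f x' y -> x = x'.

Definition surjection {M : structure} (f X Y : M) : Prop :=
  maps_to f X Y /\ forall y : M, y ∈ Y -> exists x : M, app f x y.

Definition bijection {M : structure} (f X Y : M) : Prop :=
  injection f X Y /\ surjection f X Y.

(* A cardinal is represented by any set of that size; the following relations
   compare |X| and |Y|. *)
Definition card_eq {M : structure} (X Y : M) : Prop :=
  exists f : M, bijection f X Y.

Definition card_le {M : structure} (X Y : M) : Prop :=
  is_empty X \/ exists f : M, injection f X Y.

Definition card_lt {M : structure} (X Y : M) : Prop :=
  card_le X Y /\ ~ card_eq X Y.

(* |X| <=* |Y| *)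
Definition card_le_star {M : structure} (X Y : M) : Prop :=
  is_empty X \/ exists f : M, surjection f Y X.

Definition transitive_set {M : structure} (a : M) : Prop :=
  forall x : M, x ∈ a -> subset x a.

Definition well_ordered_by_mem {M : structure} (a : M) : Prop :=
  (forall x : M, x ∈ a -> ~ x ∈ x) /\
  (forall x y z : M, x ∈ a -> y ∈ a -> z ∈ a -> x ∈ y -> y ∈ z -> x ∈ z) /\
  (forall x y : M, x ∈ a -> y ∈ a -> x ∈ y \/ x = y \/ y ∈ x) /\
  (forall s : M, subset s a -> ~ is_empty s ->
     exists x : M, x ∈ s /\ forall y : M, y ∈ s -> x = y \/ x ∈ y).

Definition ordinal {M : structure} (a : M) : Prop :=
  transitive_set a /\ well_ordered_by_mem a.

Definition initial_ordinal {M : structure} (k : M) : Prop :=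
  ordinal k /\ forall a : M, a ∈ k -> ~ card_eq a k.

(* h = aleph(|N|) *)
Definition is_hartogs {M : structure} (h N : M) : Prop :=
  forall a : M, a ∈ h <-> ordinal a /\ card_le a N.

(* l = aleph^*(|N|) *)
Definition is_lindenbaum {M : structure} (l N : M) : Prop :=
  forall a : M, a ∈ l <-> ordinal a /\ card_le_star a N.

(* Cov(L, |m|, |n|); the class L of cardinals is given by the class of sets
   whose size belongs to it. A is the family i |-> A_i, i in I. *)
Definition Cov {M : structure} (L : M -> Prop) (m n : M) : Prop :=
  exists X I A : M,
    card_eq X n /\ card_eq I m /\ function_on A I /\
    (forall i Ai : M, app A i Ai -> L Ai) /\
    (forall x : M, x ∈ X -> exists i Ai : M, app A i Ai /\ x ∈ Ai).

Definition Cov_lt {M : structure} (l m n : M) : Prop :=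
  Cov (fun K : M => card_lt K l) m n.

(* Main.v *)
(* Let [X] be covered by the [A_i], [|A_i| < lam], and let [g : X -> nu] be a
   bijection.  The image [B_i] of [A_i ∩ X] in [nu] is well-ordered by [∈], so
   it has a canonical Mostowski collapse; no choice is involved.  The collapse
   stays inside [lam], as otherwise [lam] would inject into [A_i] and be
   equinumerous with it by Cantor-Bernstein.  Sending [(b, i)] to the element of
   [B_i] with collapse [b] is a partial map of [lam * m] onto [nu].  Hence every
   ordinal injecting into [nu] is an image of [lam * m].  Lindenbaum sets exist
   by Replacement: a surjection [f] from [N] onto a transitive set is determined
   by the relation [f x ∈ f y] on [N]. *)

Require Import Defs.
From Stdlib Require Import Classical.

(** * Renaming of variables and definable predicates *)

Definition rename_under (r : nat -> nat) (n : nat) : nat :=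
  match n with O => O | S k => S (r k) end.

Fixpoint rename (r : nat -> nat) (p : formula) : formula :=
  match p with
  | fMem i j => fMem (r i) (r j)
  | fEq i j => fEq (r i) (r j)
  | fNot p => fNot (rename r p)
  | fAnd p q => fAnd (rename r p) (rename r q)
  | fOr p q => fOr (rename r p) (rename r q)
  | fImp p q => fImp (rename r p) (rename r q)
  | fAll p => fAll (rename (rename_under r) p)
  | fEx p => fEx (rename (rename_under r) p)
  end.

(** Environments are related pointwise, so crossing a binder does not call for functional
    extensionality. *)
Lemma sat_rename {M : structure} (p : formula) (r : nat -> nat) (e e' : nat -> M) :
  (forall n, e' n = e (r n)) -> (sat e (rename r p) <-> sat e' p).
Proof.
  assert (Hsc : forall (r : nat -> nat) (e e' : nat -> M) x,
    (forall n, e' n = e (r n)) ->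
    forall n, scons x e' n = scons x e (rename_under r n))
    by (intros ? ? ? ? H [|n]; [reflexivity | apply H]).
  revert r e e'; induction p as [i j|i j|p IH|p IHp q IHq|p IHp q IHq|p IHp q IHq|p IH|p IH];
    intros r e e' H; cbn;
    rewrite ?H; try rewrite (IH _ _ _ H); try rewrite (IHp _ _ _ H);
    try rewrite (IHq _ _ _ H); try reflexivity.
  - split; intros Hx x; apply (IH _ _ _ (Hsc _ _ _ x H)), Hx.
  - split; intros [x Hx]; exists x; apply (IH _ _ _ (Hsc _ _ _ x H)), Hx.
Qed.

(* Parameters of a definable predicate are read off the environment. *)
Definition definable {M : structure} (P : (nat -> M) -> Prop) : Prop :=
  exists p : formula, forall e : nat -> M, sat e p <-> P e.

Lemma definable_mem {M : structure} (i j : nat) :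
  definable (fun e : nat -> M => e i ∈ e j).
Proof. exists (fMem i j); reflexivity. Qed.

Lemma definable_eq {M : structure} (i j : nat) :
  definable (fun e : nat -> M => e i = e j).
Proof. exists (fEq i j); reflexivity. Qed.

Lemma definable_not {M : structure} (P : (nat -> M) -> Prop) :
  definable P -> definable (fun e => ~ P e).
Proof. intros [p Hp]; exists (fNot p); intro e; cbn; rewrite Hp; reflexivity. Qed.

Lemma definable_and {M : structure} (P Q : (nat -> M) -> Prop) :
  definable P -> definable Q -> definable (fun e => P e /\ Q e).
Proof.
  intros [p Hp] [q Hq]; exists (fAnd p q); intro e; cbn; rewrite Hp, Hq; reflexivity.
Qed.

Lemma definable_or {M : structure} (P Q : (nat -> M) -> Prop) :
  definable P -> definable Q -> definable (fun e => P e \/ Q e).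
Proof.
  intros [p Hp] [q Hq]; exists (fOr p q); intro e; cbn; rewrite Hp, Hq; reflexivity.
Qed.

Lemma definable_imp {M : structure} (P Q : (nat -> M) -> Prop) :
  definable P -> definable Q -> definable (fun e => P e -> Q e).
Proof.
  intros [p Hp] [q Hq]; exists (fImp p q); intro e; cbn; rewrite Hp, Hq; reflexivity.
Qed.

Lemma definable_iff {M : structure} (P Q : (nat -> M) -> Prop) :
  definable P -> definable Q -> definable (fun e => P e <-> Q e).
Proof. intros HP HQ; apply definable_and; apply definable_imp; assumption. Qed.

(** An environment for the body is split into its head, the bound variable, and its tail. For
    [scons x e] these are convertible to [x] and [e], which lets [apply] close both directions. *)
Lemma definable_all {M : structure} (P : (nat -> M) -> M -> Prop) :
  definable (fun e => P (fun n => e (S n)) (e 0)) ->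
  definable (fun e => forall x, P e x).
Proof.
  intros [p Hp]; exists (fAll p); intro e; cbn.
  split; intros H x; apply (Hp (scons x e)), H.
Qed.

Lemma definable_ex {M : structure} (P : (nat -> M) -> M -> Prop) :
  definable (fun e => P (fun n => e (S n)) (e 0)) ->
  definable (fun e => exists x, P e x).
Proof.
  intros [p Hp]; exists (fEx p); intro e; cbn.
  split; intros [x H]; exists x; apply (Hp (scons x e)), H.
Qed.

Lemma definable_rename {M : structure} (r : nat -> nat) (P Q : (nat -> M) -> Prop) :
  definable P ->
  (forall e, exists e', (forall n, e' n = e (r n)) /\ (Q e <-> P e')) ->
  definable Q.
Proof.
  intros [p Hp] H; exists (rename r p); intro e.
  destruct (H e) as (e' & He & HQ).
  rewrite (sat_rename p r e e' He), HQ; apply Hp.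
Qed.

(** Negation and equivalence are tried before implication and conjunction, into which they
    unfold. *)
Ltac definable_step :=
  cbv beta;
  first
    [ assumption
    | apply definable_mem | apply definable_eq | apply definable_not
    | apply definable_iff | apply definable_and | apply definable_or
    | apply definable_imp | apply definable_all | apply definable_ex ].

Ltac definable :=
  unfold card_le, surjection, injection, maps_to, function_on, app, is_pair, is_upair, ordinal,
    well_ordered_by_mem, transitive_set, subset, is_empty;
  repeat definable_step.

(** * Basic set theory: comprehension, pairs, products, definable relations *)

Lemma separation {M : structure} (HZF : ZF M) (P : (nat -> M) -> Prop)
  (HP : definable P) (e : nat -> M) (a : M) :
  exists b, forall x, x ∈ b <-> x ∈ a /\ P (scons x e).
Proof.
  destruct HP as [p Hp]; destruct (zf_separation M HZF p e a) as [b Hb].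
  exists b; intro x; rewrite Hb, Hp; reflexivity.
Qed.

Lemma replacement {M : structure} (HZF : ZF M) (P : (nat -> M) -> Prop)
  (HP : definable P) (e : nat -> M) (a : M) :
  (forall x y y', x ∈ a -> P (scons x (scons y e)) -> P (scons x (scons y' e)) ->
    y = y') ->
  exists b, forall y, y ∈ b <-> exists x, x ∈ a /\ P (scons x (scons y e)).
Proof.
  destruct HP as [p Hp]; intro Hfun.
  destruct (zf_replacement M HZF p e a) as [b Hb].
  - intros x y y'; rewrite !Hp; apply Hfun.
  - exists b; intro y; rewrite Hb; split; intros (x & Hx & H); exists x;
      (split; [exact Hx | apply Hp, H]).
Qed.

(** Stands in for induction along [∈]: later proofs refute a minimal counterexample, supplied by
    Foundation. *)
Lemma minimal_element {M : structure} (HZF : ZF M) (P : (nat -> M) -> Prop)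
  (HP : definable P) (e : nat -> M) (a x : M) :
  x ∈ a -> P (scons x e) ->
  exists y, y ∈ a /\ P (scons y e) /\
    forall z, z ∈ a -> z ∈ y -> ~ P (scons z e).
Proof.
  intros Hx Px; destruct (separation HZF P HP e a) as [b Hb].
  destruct (zf_foundation M HZF b) as (y & Hy & Hmin).
  - intro H; apply (H x), Hb; auto.
  - apply Hb in Hy as [Hya Py]; exists y; split; [exact Hya | split; [exact Py |]].
    intros z Hza Hzy Pz; apply (Hmin z); [apply Hb; auto | exact Hzy].
Qed.

(** The singleton of [x] lies in [z], and both shapes allowed by the other description contain [x'].
    For second coordinates, follow [y] as a member of {x, y}, then exchange the roles of the two
    descriptions. *)
Lemma pair_inj {M : structure} (HZF : ZF M) (z x y x' y' : M) :
  is_pair z x y -> is_pair z x' y' -> x = x' /\ y = y'.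
Proof.
  assert (Hfst : forall z x y x' y' : M,
    is_pair z x y -> is_pair z x' y' -> x = x').
  { clear z x y x' y'; intros z x y x' y' H H'.
    destruct (zf_pairing M HZF x x) as [s Hs].
    assert (Hsz : s ∈ z) by (apply H; left; exact Hs).
    assert (Hx : x' ∈ s) by (apply H' in Hsz as [K|K]; apply K; auto).
    apply Hs in Hx as [Hx|Hx]; auto. }
  assert (Hsnd : forall z x y x' y' : M,
    is_pair z x y -> is_pair z x' y' -> y = x' \/ y = y').
  { clear z x y x' y'; intros z x y x' y' H H'.
    destruct (zf_pairing M HZF x y) as [d Hd].
    assert (Hdz : d ∈ z) by (apply H; right; exact Hd).
    assert (Hy : y ∈ d) by (apply Hd; auto).
    apply H' in Hdz as [K|K]; apply K in Hy; tauto. }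
  intros H H'; pose proof (Hfst _ _ _ _ _ H H') as Hx; split; [exact Hx |].
  destruct (Hsnd _ _ _ _ _ H H') as [K|K]; destruct (Hsnd _ _ _ _ _ H' H) as [K'|K'];
    congruence.
Qed.

Lemma union2 {M : structure} (HZF : ZF M) (X Y : M) :
  exists U, forall z, z ∈ U <-> z ∈ X \/ z ∈ Y.
Proof.
  destruct (zf_pairing M HZF X Y) as [p Hp].
  destruct (zf_union M HZF p) as [U HU].
  exists U; intro z; rewrite HU; split.
  - intros (y & Hy & Hz); apply Hp in Hy as [->| ->]; auto.
  - intros [Hz|Hz]; [exists X | exists Y]; rewrite Hp; auto.
Qed.

Lemma pair_exists {M : structure} (HZF : ZF M) (x y : M) : exists z, is_pair z x y.
Proof.
  destruct (zf_pairing M HZF x x) as [s Hs].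
  destruct (zf_pairing M HZF x y) as [d Hd].
  destruct (zf_pairing M HZF s d) as [z Hz].
  exists z; intro u; rewrite Hz; split.
  - intros [->| ->]; auto.
  - intros [H|H]; [left | right]; apply (zf_extensionality M HZF); intro t;
      [rewrite Hs | rewrite Hd]; apply H.
Qed.

Lemma product_exists {M : structure} (HZF : ZF M) (X Y : M) :
  exists P, is_product P X Y.
Proof.
  destruct (union2 HZF X Y) as [U HU].
  destruct (zf_power M HZF U) as [PU HPU].
  destruct (zf_power M HZF PU) as [PPU HPPU].
  destruct (separation HZF
    (fun e => exists x y, x ∈ e 1 /\ y ∈ e 2 /\ is_pair (e 0) x y)
    ltac:(definable) (scons X (scons Y (fun _ => X))) PPU) as [P HP].
  cbn in HP; exists P; intro z; rewrite HP; split; [tauto |].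
  intros (x & y & Hx & Hy & Hz); split; [| exists x, y; auto].
  apply HPPU; intros u Hu; apply HPU; intros t Ht; apply HU.
  apply Hz in Hu as [Hu|Hu]; apply Hu in Ht as [->| ->]; auto.
Qed.

Lemma relation_exists {M : structure} (HZF : ZF M) (R : (nat -> M) -> Prop)
  (HR : definable R) (e : nat -> M) (X Y : M) :
  exists f,
    (forall x y, app f x y <-> x ∈ X /\ y ∈ Y /\ R (scons x (scons y e))) /\
    (forall z, z ∈ f -> exists x y, x ∈ X /\ is_pair z x y).
Proof.
  destruct (product_exists HZF X Y) as [P HP].
  assert (HD : definable (fun e : nat -> M => exists x y, is_pair (e 0) x y /\
    R (scons x (scons y (fun n => e (S n)))))).
  { apply definable_ex, definable_ex, definable_and; [definable |].
    (* Under the two quantifiers index 0 is [y], 1 is [x], 2 is the pair, and the parameters start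
       at 3. [R] expects [x], [y], then the parameters: swap the first two and skip the pair. *)
    apply (definable_rename
      (fun n => match n with 0 => 1 | 1 => 0 | S (S k) => S (S (S k)) end) R);
      [exact HR |].
    intro e0; eexists; split; [| reflexivity].
    intros [|[|n]]; reflexivity. }
  destruct (separation HZF _ HD e P) as [f Hf]; cbn in Hf.
  exists f; split.
  - intros x y; split.
    + intros (z & Hz & Hzf); apply Hf in Hzf as (HzP & x1 & y1 & Hz1 & H1).
      apply HP in HzP as (x2 & y2 & Hx2 & Hy2 & Hz2).
      destruct (pair_inj HZF _ _ _ _ _ Hz Hz1) as [-> ->].
      destruct (pair_inj HZF _ _ _ _ _ Hz1 Hz2) as [-> ->]; auto.
    + intros (Hx & Hy & H); destruct (pair_exists HZF x y) as [z Hz].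
      exists z; split; [exact Hz |]; apply Hf; split.
      * apply HP; exists x, y; auto.
      * exists x, y; auto.
  - intros z Hz; apply Hf in Hz as [Hz _]; apply HP in Hz as (x & y & Hx & _ & Hp).
    exists x, y; auto.
Qed.

(** * Functions given by formulas *)

Lemma app_dom {M : structure} (HZF : ZF M) (f X x y : M) :
  function_on f X -> app f x y -> x ∈ X.
Proof.
  intros (H & _) (z & Hz & Hzf); apply H in Hzf as (x' & y' & Hx & Hz').
  destruct (pair_inj HZF _ _ _ _ _ Hz Hz') as [-> _]; exact Hx.
Qed.

(** The function is [R] cut down to [X * Y], so uniqueness is asked only of values in [Y]. Nothing
    is chosen. *)
Lemma maps_to_intro {M : structure} (HZF : ZF M) (R : (nat -> M) -> Prop)
  (HR : definable R) (e : nat -> M) (X Y : M) :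
  (forall x, x ∈ X -> exists y, y ∈ Y /\ R (scons x (scons y e))) ->
  (forall x y y', x ∈ X -> R (scons x (scons y e)) -> R (scons x (scons y' e)) ->
    y ∈ Y -> y' ∈ Y -> y = y') ->
  exists f, maps_to f X Y /\
    forall x y, app f x y <-> x ∈ X /\ y ∈ Y /\ R (scons x (scons y e)).
Proof.
  intros Htot Hfun; destruct (relation_exists HZF R HR e X Y) as (f & Hf & Hz).
  exists f; split; [| exact Hf]; split; [split; [exact Hz | split] |].
  - intros x Hx; destruct (Htot x Hx) as (y & Hy & H); exists y; apply Hf; auto.
  - intros x y y' H H'; apply Hf in H as (Hx & Hy & H); apply Hf in H' as (_ & Hy' & H').
    eauto.
  - intros x y H; apply Hf in H; tauto.
Qed.

(** * Comparison of cardinals without choice *)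

(** A Knaster-Tarski fixed point avoids recursion on natural numbers. The bijection is [f] on the
    fixed point [D] and the inverse of [k] off it. *)
Lemma cantor_bernstein {M : structure} (HZF : ZF M) (f k X Y : M) :
  injection f X Y -> injection k Y X -> card_eq X Y.
Proof.
  intros [[Ff Rf] If] [[Fk Rk] Ik].
  (* [D] is the largest fixed point of [Z |-> X \ k[Y \ f[Z]]]. *)
  destruct (separation HZF
    (fun e => exists Z, e 0 ∈ Z /\ subset Z (e 1) /\
       forall t y, t ∈ Z -> app (e 3) y t -> exists s, s ∈ Z /\ app (e 2) s y)
    ltac:(definable) (scons X (scons f (fun _ => k))) X) as [D HD].
  cbn in HD.
  assert (Hpost : forall t y, t ∈ D -> app k y t -> exists s, s ∈ D /\ app f s y).
  { intros t y Ht Hk; apply HD in Ht as (HtX & Z & HtZ & HZX & HZ).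
    destruct (HZ t y HtZ Hk) as (s & Hs & Hf); exists s; split; [| exact Hf].
    apply HD; split; [apply HZX, Hs | exists Z; auto]. }
  (* Under this hypothesis [D] with [x] adjoined is again a post-fixed point, hence part of their
     union [D]. *)
  assert (Hpre : forall x, x ∈ X ->
    (forall y, app k y x -> exists s, s ∈ D /\ app f s y) -> x ∈ D).
  { intros x Hx H.
    destruct (separation HZF (fun e => e 0 ∈ e 1 \/ e 0 = e 2) ltac:(definable)
      (scons D (fun _ => x)) X) as [Z HZ]; cbn in HZ.
    apply HD; split; [exact Hx |]; exists Z; split; [apply HZ; auto | split].
    - intros t Ht; apply HZ in Ht; tauto.
    - intros t y Ht Hk; apply HZ in Ht as [_ Ht].
      assert (Hs : exists s, s ∈ D /\ app f s y)
        by (destruct Ht as [Ht| ->]; eauto).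
      destruct Hs as (s & Hs & Hf); exists s; split; [| exact Hf].
      apply HZ; split; [apply HD in Hs; tauto | auto]. }
  assert (Hout : forall x, x ∈ X -> ~ x ∈ D ->
    exists y, app k y x /\ forall s, s ∈ D -> ~ app f s y).
  { intros x Hx HnD; apply NNPP; intro H; apply HnD, (Hpre x Hx).
    intros y Hk; apply NNPP; intro H'; apply H; exists y; split; [exact Hk |].
    intros s Hs Hf; apply H'; eauto. }
  destruct (maps_to_intro HZF
    (fun e => (e 0 ∈ e 2 /\ app (e 3) (e 0) (e 1)) \/
              (~ e 0 ∈ e 2 /\ app (e 4) (e 1) (e 0)))
    ltac:(definable) (scons D (scons f (fun _ => k))) X Y) as (h & Hh & Happ);
    cbn in *.
  - intros x Hx; destruct (classic (x ∈ D)) as [HxD|HxD].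
    + destruct Ff as (_ & Tf & _); destruct (Tf x Hx) as [y Hy].
      exists y; split; eauto.
    + destruct (Hout x Hx HxD) as (y & Hy & _); exists y; split; [| auto].
      exact (app_dom HZF _ _ _ _ Fk Hy).
  - intros x y y' _ [[H1 H2]|[H1 H2]] [[H3 H4]|[H3 H4]] _ _; try tauto.
    + destruct Ff as (_ & _ & Uf); eauto.
    + eauto.
  - exists h; split; split; try exact Hh.
    + assert (Hmix : forall x x' y, x ∈ D -> x' ∈ X -> ~ x' ∈ D ->
        app f x y -> app k y x' -> False).
      { intros x x' y Hx HxX' Hx' Hf Hk.
        destruct (Hout x' HxX' Hx') as (y' & Hy' & Hno).
        apply (Hno x Hx); rewrite (Ik _ _ _ Hy' Hk); exact Hf. }
      intros x x' y H H'; apply Happ in H as (Hx & Hy & H).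
      apply Happ in H' as (Hx' & _ & H').
      destruct H as [[H1 H2]|[H1 H2]], H' as [[H3 H4]|[H3 H4]].
      * eauto.
      * destruct (Hmix x x' y); auto.
      * destruct (Hmix x' x y); auto.
      * destruct Fk as (_ & _ & Uk); eauto.
    + intros y Hy; destruct Fk as (Gk & Tk & Uk); destruct (Tk y Hy) as [x Hx].
      pose proof (Rk _ _ Hx) as HxX.
      destruct (classic (x ∈ D)) as [HxD|HxD].
      * destruct (Hpost x y HxD Hx) as (s & Hs & Hf); exists s; apply Happ.
        split; [apply HD in Hs; tauto | auto].
      * exists x; apply Happ; auto.
Qed.

(** When [X] is empty, the empty function serves. *)
Lemma card_le_injection {M : structure} (HZF : ZF M) (X Y : M) :
  card_le X Y -> exists f, injection f X Y.
Proof.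
  intros [HX|H]; [| exact H].
  destruct (maps_to_intro HZF (fun e => e 0 = e 1) ltac:(definable) (fun _ => X) X Y)
    as (f & Hf & Happ).
  - intros x Hx; destruct (HX x Hx).
  - intros x y y' Hx; destruct (HX x Hx).
  - exists f; split; [exact Hf |]; intros x x' y H; apply Happ in H as [H _].
    destruct (HX x H).
Qed.

(** A partial map of [X] onto a nonempty [Y] becomes total by sending every point outside its domain
    to one fixed [y0]. *)
Lemma card_le_star_of_partial {M : structure} (HZF : ZF M) (R : (nat -> M) -> Prop)
  (HR : definable R) (e : nat -> M) (X Y : M) :
  (forall x y y', x ∈ X -> y ∈ Y -> y' ∈ Y ->
    R (scons x (scons y e)) -> R (scons x (scons y' e)) -> y = y') ->
  (forall y, y ∈ Y -> exists x, x ∈ X /\ R (scons x (scons y e))) ->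
  card_le_star Y X.
Proof.
  intros Hfun Hsur; destruct (classic (is_empty Y)) as [HY|HY]; [left; exact HY | right].
  apply not_all_ex_not in HY as [y0 Hy0]; apply NNPP in Hy0.
  destruct (relation_exists HZF R HR e X Y) as (r & Hr & _).
  destruct (maps_to_intro HZF
    (fun e => app (e 2) (e 0) (e 1) \/
      ((forall u, ~ app (e 2) (e 0) u) /\ e 1 = e 3))
    ltac:(definable) (scons r (fun _ => y0)) X Y) as (f & Hf & Happ); cbn in *.
  - intros x Hx; destruct (classic (exists u, app r x u)) as [[u Hu]|H].
    + exists u; split; [apply Hr in Hu; tauto | auto].
    + exists y0; split; [exact Hy0 | right; split; [| reflexivity]].
      intros u Hu; apply H; eauto.
  - intros x y y' Hx [H|[H1 H2]] [H'|[H1' H2']] Hy Hy'.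
    + apply Hr in H as (_ & _ & H); apply Hr in H' as (_ & _ & H'); eauto.
    + destruct (H1' _ H).
    + destruct (H1 _ H').
    + congruence.
  - exists f; split; [exact Hf |]; intros y Hy.
    destruct (Hsur y Hy) as (x & Hx & H); exists x; apply Happ.
    split; [exact Hx | split; [exact Hy | left; apply Hr; auto]].
Qed.

Lemma card_le_star_refl {M : structure} (HZF : ZF M) (X : M) : card_le_star X X.
Proof.
  apply (card_le_star_of_partial HZF (fun e => e 0 = e 1) ltac:(definable) (fun _ => X));
    cbn; [congruence | eauto].
Qed.

(** With [f] injecting [X] into [Y] and [g] mapping [Z] onto [Y], the inverse of [f] after [g] is a
    partial map of [Z] onto [X]. *)
Lemma card_le_le_star_trans {M : structure} (HZF : ZF M) (X Y Z : M) :
  card_le X Y -> card_le_star Y Z -> card_le_star X Z.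
Proof.
  intros HXY HYZ; destruct (card_le_injection HZF X Y HXY) as [f [[[Gf [Tf Uf]] Rf] If]].
  destruct HYZ as [HY|[g [[[Gg [Tg Ug]] Rg] Sg]]].
  - left; intros x Hx; destruct (Tf x Hx) as [y Hy]; exact (HY y (Rf _ _ Hy)).
  - apply (card_le_star_of_partial HZF
      (fun e => exists u, app (e 2) (e 1) u /\ app (e 3) (e 0) u) ltac:(definable)
      (scons f (fun _ => g))); cbn.
    + intros z x x' _ _ _ (u & Hu & Hz) (u' & Hu' & Hz').
      rewrite (Ug _ _ _ Hz' Hz) in Hu'; eauto.
    + intros x Hx; destruct (Tf x Hx) as [u Hu].
      destruct (Sg u (Rf _ _ Hu)) as [z Hz]; exists z.
      split; [exact (app_dom HZF g Z z u (conj Gg (conj Tg Ug)) Hz) | eauto].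
Qed.

(** * Mostowski collapse of a set of ordinals *)

(* The domain of [c] need not lie in [B]; what matters is that it contains every
   element of [B] below one of its members. *)
Definition collapse {M : structure} (B c : M) : Prop :=
  forall z v : M, app c z v ->
    (forall u, u ∈ v <-> exists w, w ∈ B /\ w ∈ z /\ app c w u) /\
    (forall w, w ∈ B -> w ∈ z -> exists u, app c w u).

(** The Mostowski collapse of [B], evaluated at [z]. Quantifying over approximations [c] turns the
    recursion into a first-order formula, available to Separation. *)
Definition rank_in {M : structure} (B z v : M) : Prop :=
  z ∈ B /\ exists c : M, collapse B c /\ app c z v.

(** At a minimal point of disagreement both values have the same elements. The case [c = c'] says
    that an approximation is single-valued on [B]. *)
Lemma collapse_unique {M : structure} (HZF : ZF M) (B c c' z v v' : M) :
  collapse B c -> collapse B c' -> z ∈ B -> app c z v -> app c' z v' -> v = v'.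
Proof.
  intros Hc Hc' Hz Hv Hv'; apply NNPP; intro Hne.
  destruct (minimal_element HZF
    (fun e => exists v v', app (e 1) (e 0) v /\ app (e 2) (e 0) v' /\ ~ v = v')
    ltac:(definable) (scons c (fun _ => c')) B z)
    as (y & Hy & (t & t' & Ht & Ht' & Hneq) & Hmin); cbn in *; [exact Hz | eauto |].
  apply Hneq, (zf_extensionality M HZF); intro u.
  destruct (Hc y t Ht) as [E D]; destruct (Hc' y t' Ht') as [E' D'].
  assert (Heq : forall w s s', w ∈ B -> w ∈ y -> app c w s -> app c' w s' -> s = s').
  { intros w s s' HwB Hwy Hs Hs'; apply NNPP; intro H; apply (Hmin w HwB Hwy).
    exists s, s'; auto. }
  rewrite E, E'; split; intros (w & HwB & Hwy & Hw); exists w;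
    (split; [exact HwB | split; [exact Hwy |]]).
  - destruct (D' w HwB Hwy) as [s Hs]; rewrite (Heq w u s HwB Hwy Hw Hs); exact Hs.
  - destruct (D w HwB Hwy) as [s Hs]; rewrite <- (Heq w s u HwB Hwy Hs Hw); exact Hs.
Qed.

Lemma rank_in_unique {M : structure} (HZF : ZF M) (B z v v' : M) :
  rank_in B z v -> rank_in B z v' -> v = v'.
Proof.
  intros (Hz & c & Hc & Hv) (_ & c' & Hc' & Hv').
  exact (collapse_unique HZF B c c' z v v' Hc Hc' Hz Hv Hv').
Qed.

(** Approximations agree on [B], so the recursion equation of a single [c] passes to [rank_in]. *)
Lemma rank_in_spec {M : structure} (HZF : ZF M) (B z v : M) :
  rank_in B z v ->
  forall u, u ∈ v <-> exists w, w ∈ B /\ w ∈ z /\ rank_in B w u.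
Proof.
  intros (Hz & c & Hc & Hv) u; destruct (Hc z v Hv) as [E D]; rewrite E.
  split; intros (w & HwB & Hwz & Hw); exists w; (split; [exact HwB | split; [exact Hwz |]]).
  - split; [exact HwB | exists c; auto].
  - destruct Hw as (_ & c' & Hc' & Hw); destruct (D w HwB Hwz) as [s Hs].
    rewrite <- (collapse_unique HZF B c c' w s u Hc Hc' HwB Hs Hw); exact Hs.
Qed.

(** Two distinct elements of [B] are comparable in [nu]; the collapse preserves [∈], so a common
    value [u] would satisfy [u ∈ u]. *)
Lemma rank_in_inj {M : structure} (HZF : ZF M) (nu B lam w w' u : M) :
  ordinal nu -> ordinal lam -> subset B nu -> u ∈ lam ->
  rank_in B w u -> rank_in B w' u -> w = w'.
Proof.
  intros (_ & _ & _ & Htri & _) (_ & Hirr & _) HB Hu Hw Hw'.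
  pose proof (proj1 Hw) as HwB; pose proof (proj1 Hw') as HwB'.
  destruct (Htri w w' (HB _ HwB) (HB _ HwB')) as [H|[H|H]]; [| exact H |];
    destruct (Hirr u Hu).
  - apply (rank_in_spec HZF B w' u Hw'); eauto.
  - apply (rank_in_spec HZF B w u Hw); eauto.
Qed.

(** If [V] is not all of [a], then [V] equals the least [t] of [a] outside it: [t ⊆ V] by
    minimality, and an element of [V] not below [t] would put [t] into [V]. *)
Lemma transitive_subset_ordinal {M : structure} (HZF : ZF M) (V a : M) :
  ordinal a -> subset V a -> transitive_set V -> V = a \/ V ∈ a.
Proof.
  intros (Hta & Hirr & Htr & Htri & Hwo) HVa HtV.
  destruct (classic (subset a V)) as [H|H].
  - left; apply (zf_extensionality M HZF); intro z; split; auto.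
  - right; apply not_all_ex_not in H as [x Hx]; apply imply_to_and in Hx as [Hxa HxV].
    destruct (minimal_element HZF (fun e => ~ e 0 ∈ e 1) ltac:(definable)
      (fun _ => V) a x) as (t & Hta' & HtnV & Hmin); cbn in *; auto.
    replace V with t; [exact Hta' |].
    apply (zf_extensionality M HZF); intro u; split; intro Hu.
    + apply NNPP; exact (Hmin u (Hta t Hta' u Hu) Hu).
    + destruct (Htri u t (HVa u Hu) Hta') as [K|[K|K]]; [exact K | |].
      * subst u; contradiction.
      * destruct (HtnV (HtV u Hu t K)).
Qed.

(** For a minimal [z] without a rank in [lam], the set [V] of ranks of elements of [B] below [z] is
    transitive. Either [V = lam], and inverting the ranks injects [lam] into [B], or [V ∈ lam], and
    [V] is itself the rank of [z]. *)
Lemma rank_in_exists {M : structure} (HZF : ZF M) (nu lam B : M) :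
  ordinal nu -> ordinal lam -> subset B nu -> ~ (exists f, injection f lam B) ->
  forall z, z ∈ B -> exists v, v ∈ lam /\ rank_in B z v.
Proof.
  intros Hnu Hlam HB Hno z0 Hz0; apply NNPP; intro Hnot.
  destruct (minimal_element HZF
    (fun e => ~ exists v, v ∈ e 1 /\ rank_in (e 2) (e 0) v)
    ltac:(unfold rank_in, collapse; definable) (scons lam (fun _ => B)) B z0)
    as (z & HzB & Hz & Hmin); cbn in *; auto.
  assert (Hbelow : forall w, w ∈ B -> w ∈ z -> exists v, v ∈ lam /\ rank_in B w v)
    by (intros w HwB Hwz; apply NNPP; exact (Hmin w HwB Hwz)).
  assert (Hztr : forall w w', w ∈ B -> w' ∈ B -> w' ∈ w -> w ∈ z -> w' ∈ z).
  { intros w w' HwB HwB' H H'; destruct Hnu as (_ & _ & Htr & _).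
    apply (Htr w' w z); auto. }
  destruct (separation HZF (fun e => exists w, w ∈ e 1 /\ w ∈ e 2 /\ rank_in (e 1) w (e 0))
    ltac:(unfold rank_in, collapse; definable) (scons B (fun _ => z)) lam) as [V HV].
  cbn in HV.
  destruct (transitive_subset_ordinal HZF V lam Hlam) as [E|HVl].
  - intros u Hu; apply HV in Hu; tauto.
  - intros u Hu t Ht; apply HV in Hu as (Hul & w & HwB & Hwz & Hw).
    apply (rank_in_spec HZF B w u Hw) in Ht as Ht'.
    destruct Ht' as (w' & HwB' & Hww & Hw').
    apply HV; split; [exact (proj1 Hlam u Hul t Ht) |].
    exists w'; eauto.
  - subst V; apply Hno.
    destruct (maps_to_intro HZF (fun e => e 1 ∈ e 3 /\ rank_in (e 2) (e 1) (e 0))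
      ltac:(unfold rank_in, collapse; definable) (scons B (fun _ => z)) lam B)
      as (f & Hf & Happ); cbn in *.
    + intros u Hu; apply HV in Hu as (_ & w & HwB & Hwz & Hw); eauto.
    + intros u w w' Hu [_ Hw] [_ Hw'] _ _.
      exact (rank_in_inj HZF nu B lam w w' u Hnu Hlam HB Hu Hw Hw').
    + exists f; split; [exact Hf |]; intros u u' w H H'.
      apply Happ in H as (_ & _ & _ & H); apply Happ in H' as (_ & _ & _ & H').
      exact (rank_in_unique HZF B w u u' H H').
  - apply Hz; exists V; split; [exact HVl |]; split; [exact HzB |].
    assert (Hzz : ~ z ∈ z) by (apply (proj1 (proj2 Hnu)), HB, HzB).
    destruct (zf_pairing M HZF V V) as [sV HsV].
    destruct (union2 HZF lam sV) as [U HU].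
    (* The approximation witnessing the rank of [z]: the ranks below [z], extended by the pair of
       [z] and [V]. *)
    destruct (relation_exists HZF
      (fun e => (e 0 ∈ e 3 /\ rank_in (e 2) (e 0) (e 1)) \/ (e 0 = e 3 /\ e 1 = e 4))
      ltac:(unfold rank_in, collapse; definable)
      (scons B (scons z (fun _ => V))) B U) as (c & Hc & _); cbn in Hc.
    (* Since [z] is not in [z], the added pair does not disturb [c] below [z]. *)
    assert (Hlow : forall w u, w ∈ z -> (app c w u <-> u ∈ lam /\ rank_in B w u)).
    { intros w u Hwz; rewrite Hc, HU, HsV; split.
      - intros (HwB & _ & [[_ H]|[H _]]); [| subst w; contradiction].
        destruct (Hbelow w HwB Hwz) as (v & Hv & Hv').
        rewrite (rank_in_unique HZF B w u v H Hv'); auto.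
      - intros [Hu H]; split; [exact (proj1 H) | auto]. }
    exists c; split.
    + intros y v Hy; apply Hc in Hy as (HyB & HvU & [[Hyz Hyv]|[-> ->]]).
      * assert (Hvl : v ∈ lam).
        { destruct (Hbelow y HyB Hyz) as (v' & Hv' & H).
          rewrite (rank_in_unique HZF B y v v' Hyv H); exact Hv'. }
        split.
        -- intro u; split.
           ++ intro Hu; apply (rank_in_spec HZF B y v Hyv) in Hu as Hu'.
              destruct Hu' as (w & HwB & Hwy & Hw); exists w.
              split; [exact HwB | split; [exact Hwy |]].
              apply Hlow; [eauto |]; split; [exact (proj1 Hlam v Hvl u Hu) | exact Hw].
           ++ intros (w & HwB & Hwy & Hw); apply Hlow in Hw as [_ Hw]; [| eauto].
              apply (rank_in_spec HZF B y v Hyv); eauto.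
        -- intros w HwB Hwy; assert (Hwz : w ∈ z) by eauto.
           destruct (Hbelow w HwB Hwz) as (u & Hu & H); exists u; apply Hlow; auto.
      * split.
        -- intro u; rewrite HV; split.
           ++ intros (Hu & w & HwB & Hwz & Hw); exists w.
              split; [exact HwB | split; [exact Hwz |]]; apply Hlow; auto.
           ++ intros (w & HwB & Hwz & Hw); apply Hlow in Hw as [Hu Hw]; [| exact Hwz].
              split; [exact Hu | eauto].
        -- intros w HwB Hwz.
           destruct (Hbelow w HwB Hwz) as (u & Hu & H); exists u; apply Hlow; auto.
    + apply Hc; split; [exact HzB | split; [| auto]].
      apply HU; right; apply HsV; auto.
Qed.

(** * From a cover to a surjection *)

Lemma card_lt_no_injection {M : structure} (HZF : ZF M) (K lam : M) :
  card_lt K lam -> ~ exists f, injection f lam K.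
Proof.
  intros [Hle Hne] [f Hf]; destruct (card_le_injection HZF K lam Hle) as [k Hk].
  exact (Hne (cantor_bernstein HZF k f K lam Hk Hf)).
Qed.

(* B = g[A_i ∩ X], where X is the domain of g *)
Definition trace {M : structure} (nu A g i B : M) : Prop :=
  forall y : M, y ∈ B <->
    y ∈ nu /\ exists Ai x, app A i Ai /\ x ∈ Ai /\ app g x y.

(** The partial map sends (b, j) to the element of rank [b] in the trace of [A_i], where [h] takes
    [i] to [j]. The formula records [b ∈ lam] because [rank_in_inj] relies on it. *)
Lemma Cov_lt_card_le_star {M : structure} (HZF : ZF M) (lam nu m P : M) :
  ordinal lam -> ordinal nu -> is_product P lam m -> Cov_lt lam m nu ->
  card_le_star nu P.
Proof.
  intros Hlam Hnu HP (X & I & A & [g Hg] & [h Hh] & HA & HL & Hcov).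
  destruct Hg as [[[Fg Rg] Ig] [_ Sg]].
  destruct Hh as [[[Fh Rh] Ih] [_ Sh]].
  apply (card_le_star_of_partial HZF
    (fun e => exists b j i B, is_pair (e 0) b j /\ b ∈ e 6 /\ app (e 2) i j /\
      trace (e 3) (e 4) (e 5) i B /\ rank_in B (e 1) b)
    ltac:(unfold rank_in, collapse, trace; definable)
    (scons h (scons nu (scons A (scons g (fun _ => lam)))))); cbn.
  - intros p y y' _ _ _ (b & j & i & B & Hp & Hb & Hi & HB & Hy)
      (b' & j' & i' & B' & Hp' & _ & Hi' & HB' & Hy').
    destruct (pair_inj HZF _ _ _ _ _ Hp Hp') as [<- <-].
    (* Injectivity of [h] recovers the index [i] from [j]; the trace is then determined by
       extensionality. *)
    rewrite (Ih _ _ _ Hi' Hi) in HB'.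
    assert (B' = B) as -> by (apply (zf_extensionality M HZF); intro t;
      rewrite (HB t), (HB' t); reflexivity).
    apply (rank_in_inj HZF nu B lam y y' b Hnu Hlam); auto.
    intros t Ht; apply HB in Ht; tauto.
  - intros y Hy; destruct (Sg y Hy) as [x Hx].
    destruct (Hcov x (app_dom HZF _ _ _ _ Fg Hx)) as (i & Ai & HAi & HxAi).
    pose proof (app_dom HZF _ _ _ _ HA HAi) as HiI.
    destruct (proj1 (proj2 Fh) i HiI) as [j Hj].
    destruct (separation HZF
      (fun e => exists Ai x, app (e 1) (e 2) Ai /\ x ∈ Ai /\ app (e 3) x (e 0))
      ltac:(definable) (scons A (scons i (fun _ => g))) nu) as [B HB]; cbn in HB.
    assert (HBnu : subset B nu) by (intros t Ht; apply HB in Ht; tauto).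
    assert (HBA : forall t, t ∈ B -> exists s, s ∈ Ai /\ app g s t).
    { intros t Ht; apply HB in Ht as (_ & Ai' & s & HAi' & Hs & Hst).
      rewrite (proj2 (proj2 HA) _ _ _ HAi' HAi) in Hs; eauto. }
    (* An injection into [B] lifts to [Ai] along [g], whose preimages are unique, so the lift needs
       no choice. *)
    assert (Hno : ~ exists f, injection f lam B).
    { intros [f [[Ff Rf] If]]; apply (card_lt_no_injection HZF Ai lam (HL i Ai HAi)).
      destruct (maps_to_intro HZF
        (fun e => exists t, app (e 2) (e 0) t /\ app (e 3) (e 1) t) ltac:(definable)
        (scons f (fun _ => g)) lam Ai) as (f' & Hf' & Happ); cbn in *.
      - intros u Hu; destruct (proj1 (proj2 Ff) u Hu) as [t Ht].
        destruct (HBA t (Rf _ _ Ht)) as (s & Hs & Hst); eauto.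
      - intros u s s' _ (t & Ht & Hst) (t' & Ht' & Hst') _ _.
        rewrite (proj2 (proj2 Ff) _ _ _ Ht' Ht) in Hst'; eauto.
      - exists f'; split; [exact Hf' |]; intros u u' s H H'.
        apply Happ in H as (_ & _ & t & Ht & Hst).
        apply Happ in H' as (_ & _ & t' & Ht' & Hst').
        rewrite (proj2 (proj2 Fg) _ _ _ Hst' Hst) in Ht'; eauto. }
    assert (HyB : y ∈ B) by (apply HB; split; [exact Hy | eauto]).
    destruct (rank_in_exists HZF nu lam B Hnu Hlam HBnu Hno y HyB) as (b & Hb & Hyb).
    destruct (pair_exists HZF b j) as [p Hp].
    exists p; split; [apply HP; exists b, j; eauto |].
    exists b, j, i, B; auto.
Qed.

(** * Existence of Lindenbaum and Hartogs sets *)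

(** Both maps collapse the same relation on [N]. At a minimal value of [f] where they differ,
    transitivity and surjectivity show that the two values have the same elements; hence [f] and
    [f'] agree, and so do their ranges. *)
Lemma surjection_transitive_unique {M : structure} (HZF : ZF M) (N a a' f f' : M) :
  transitive_set a -> transitive_set a' -> surjection f N a -> surjection f' N a' ->
  (forall x y u v u' v', app f x u -> app f y v -> app f' x u' -> app f' y v' ->
    (u ∈ v <-> u' ∈ v')) ->
  subset a a'.
Proof.
  intros Ha Ha' [[Ff Rf] Sf] [[Ff' Rf'] Sf'] Hiso.
  assert (Heq : forall x u u', app f x u -> app f' x u' -> u = u').
  { intros x0 u0 u0' H0 H0'; apply NNPP; intro Hne.
    destruct (minimal_element HZF
      (fun e => exists x u', app (e 1) x (e 0) /\ app (e 2) x u' /\ ~ e 0 = u')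
      ltac:(definable) (scons f (fun _ => f')) a u0)
      as (v & Hva & (y & v' & Hv & Hv' & Hneq) & Hmin); cbn in *; eauto.
    apply Hneq, (zf_extensionality M HZF); intro u.
    assert (Hlow : forall x s s', s ∈ v -> app f x s -> app f' x s' -> s = s').
    { intros x s s' Hs Hx Hx'; apply NNPP; intro K.
      apply (Hmin s (Ha v Hva s Hs) Hs); exists x, s'; auto. }
    split; intro Hu.
    - destruct (Sf u (Ha v Hva u Hu)) as [x Hx].
      destruct (proj1 (proj2 Ff') x (app_dom HZF _ _ _ _ Ff Hx)) as [s Hs].
      rewrite (Hlow x u s Hu Hx Hs); apply (Hiso x y u v s v'); auto.
    - destruct (Sf' u (Ha' v' (Rf' _ _ Hv') u Hu)) as [x Hx].
      destruct (proj1 (proj2 Ff) x (app_dom HZF _ _ _ _ Ff' Hx)) as [s Hs].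
      assert (Hsv : s ∈ v) by (apply (Hiso x y s v u v'); auto).
      rewrite <- (Hlow x s u Hsv Hs Hx); exact Hsv. }
  intros u Hu; destruct (Sf u Hu) as [x Hx].
  destruct (proj1 (proj2 Ff') x (app_dom HZF _ _ _ _ Ff Hx)) as [s Hs].
  rewrite (Heq x u s Hx Hs); exact (Rf' _ _ Hs).
Qed.

Lemma ordinal_empty {M : structure} (a : M) : is_empty a -> ordinal a.
Proof.
  intro H; split; [intros x Hx; destruct (H x Hx) |].
  split; [intros x Hx; destruct (H x Hx) |].
  split; [intros x y z Hx; destruct (H x Hx) |].
  split; [intros x y Hx; destruct (H x Hx) |].
  intros s Hs Hne; exfalso; apply Hne; intros x Hx; exact (H x (Hs x Hx)).
Qed.

Lemma lindenbaum_exists {M : structure} (HZF : ZF M) (N : M) :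
  exists l, is_lindenbaum l N.
Proof.
  destruct (product_exists HZF N N) as [NN HNN].
  destruct (zf_power M HZF NN) as [PN HPN].
  (* Replacement along [W] to [a] over all relations [W] on [N], where [W] is the pullback of [∈]
     under some surjection of [N] onto [a]. *)
  destruct (replacement HZF
    (fun e => ordinal (e 1) /\ exists f, surjection f (e 2) (e 1) /\
      forall x y u v, app f x u -> app f y v -> (app (e 0) x y <-> u ∈ v))
    ltac:(definable) (fun _ => N) PN) as [b Hb]; cbn in *.
  { intros W a a' _ (Ha & f & Hf & HW) (Ha' & f' & Hf' & HW').
    apply (zf_extensionality M HZF); intro z; split; revert z.
    - apply (surjection_transitive_unique HZF N a a' f f' (proj1 Ha) (proj1 Ha') Hf Hf').
      intros x y u v u' v' H1 H2 H3 H4.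
      rewrite <- (HW x y u v H1 H2); auto.
    - apply (surjection_transitive_unique HZF N a' a f' f (proj1 Ha') (proj1 Ha) Hf' Hf).
      intros x y u v u' v' H1 H2 H3 H4.
      rewrite <- (HW' x y u v H1 H2); auto. }
  (* The empty ordinal is adjoined separately: it belongs to the Lindenbaum set by convention,
     although a nonempty [N] has no map onto it. *)
  destruct (separation HZF (fun e => ~ e 0 = e 0) ltac:(definable) (fun _ => N) N)
    as [o Ho]; cbn in Ho.
  assert (Hoe : is_empty o) by (intros x Hx; apply Ho in Hx; tauto).
  destruct (zf_pairing M HZF o o) as [so Hso].
  destruct (union2 HZF b so) as [l Hl].
  exists l; intro a; rewrite Hl, Hso; split.
  - intros [Ha|Ha].
    + apply Hb in Ha as (W & _ & Ha & f & Hf & _).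
      split; [exact Ha | right; exists f; exact Hf].
    + assert (a = o) as -> by tauto; split; [apply ordinal_empty, Hoe | left; exact Hoe].
  - intros [Ha [He|[f Hf]]].
    + right; left; apply (zf_extensionality M HZF); intro z; split; intro Hz;
        [destruct (He z Hz) | destruct (Hoe z Hz)].
    + left; apply Hb.
      destruct (separation HZF
        (fun e => exists x y u v, is_pair (e 0) x y /\ app (e 1) x u /\ app (e 1) y v /\
          u ∈ v)
        ltac:(definable) (fun _ => f) NN) as [W HW]; cbn in HW.
      exists W; split; [apply HPN; intros z Hz; apply HW in Hz; tauto |].
      split; [exact Ha |]; exists f; split; [exact Hf |].
      destruct Hf as [[Ff Rf] Sf].
      intros x y u v Hx Hy; split.
      * intros (z & Hz & HzW); apply HW in HzW as (_ & x' & y' & u' & v' & Hz' & Hx' & Hy' & Huv).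
        destruct (pair_inj HZF _ _ _ _ _ Hz Hz') as [<- <-].
        rewrite (proj2 (proj2 Ff) _ _ _ Hx Hx'), (proj2 (proj2 Ff) _ _ _ Hy Hy').
        exact Huv.
      * intro Huv; destruct (pair_exists HZF x y) as [z Hz].
        exists z; split; [exact Hz |]; apply HW; split.
        -- apply HNN; exists x, y; split; [| split]; [| | exact Hz];
             eapply (app_dom HZF); eassumption.
        -- exists x, y, u, v; auto.
Qed.

(** An ordinal that injects into [N] is also an image of [N] in the sense of [card_le_star], so
    Separation cuts the Hartogs set out of the Lindenbaum set. *)
Lemma hartogs_exists {M : structure} (HZF : ZF M) (N : M) :
  exists h, is_hartogs h N.
Proof.
  destruct (lindenbaum_exists HZF N) as [l Hl].
  destruct (separation HZF (fun e => card_le (e 0) (e 1)) ltac:(definable)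
    (fun _ => N) l) as [h Hh]; cbn in Hh.
  exists h; intro a; rewrite Hh, (Hl a); split; [tauto |].
  intros [Ha Hle]; split; [split; [exact Ha |] | exact Hle].
  exact (card_le_le_star_trans HZF a N N Hle (card_le_star_refl HZF N)).
Qed.

(** * Comparison of the Hartogs and Lindenbaum numbers *)

Lemma card_le_subset {M : structure} (HZF : ZF M) (X Y : M) :
  subset X Y -> card_le X Y.
Proof.
  intro H; right.
  destruct (maps_to_intro HZF (fun e => e 0 = e 1) ltac:(definable) (fun _ => X) X Y)
    as (f & Hf & Happ); cbn in *; [eauto | congruence |].
  exists f; split; [exact Hf |].
  intros x x' y Hx Hx'; apply Happ in Hx, Hx'; intuition congruence.
Qed.

Theorem theorem1 (M : structure) (HZF : ZF M) (lam nu m : M)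
  (Hlam : initial_ordinal lam) (Hnu : initial_ordinal nu)
  (Hcov : Cov_lt lam m nu) :
  exists lam_m : M, is_product lam_m lam m /\
    card_le_star nu lam_m /\
    exists nu_plus aleph_star : M,
      is_hartogs nu_plus nu /\
      is_lindenbaum aleph_star lam_m /\
      card_le nu_plus aleph_star.
Proof.
  destruct (product_exists HZF lam m) as [P HP].
  pose proof (Cov_lt_card_le_star HZF lam nu m P (proj1 Hlam) (proj1 Hnu) HP Hcov)
    as Hstar.
  destruct (hartogs_exists HZF nu) as [h Hh].
  destruct (lindenbaum_exists HZF P) as [l Hl].
  exists P; split; [exact HP | split; [exact Hstar |]].
  exists h, l; split; [exact Hh | split; [exact Hl |]].
  (* The inequality is obtained as an inclusion of sets of ordinals. *)
  apply (card_le_subset HZF); intros a Ha; apply Hh in Ha as [Ha Hle].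
  apply Hl; split; [exact Ha |].
  exact (card_le_le_star_trans HZF a nu P Hle Hstar).
Qed.
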